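(* For every $n\ge 0$ there is an online strategy for exploring $n$-tadpole graphs with $n+2$ agents which has competitive ratio $1$ in the energy model and competitive ratio $1.5+\frac{n}{2}$ in the time model.
   Context: Multi-agent online graph exploration: an undirected connected graph $G=(V,E)$ with positive edge lengths $l(e)$ and distinctly labelled nodes is initially unknown. $k$ agents start at a node $s$; initially they know $s$, its incident edges (with lengths) and its neighbours. Whenever an agent visits a node $v$ for the first time, all edges incident to $v$ (with lengths) and the neighbours of $v$ are revealed. Agents share all information instantly, have unlimited computation, move at unit speed (traversing $e$ takes time $l(e)$), and may wait. The exploration is finished when every node has been visited and all agents are back at $s$. Time model: cost is the finishing time. Energy model: cost is the maximum total distance travelled by any single agent. $opt(G,s,k)$ is the minimum cost of an exploration by $k$ agents with full prior knowledge of $G$; a strategy has competitive ratio $c$ on a class if $c$ is the supremum of its cost divided by $opt(G,s,k)$ over all $G$ in the class and $s\in V$. An $n$-tadpole graph consists of a cycle to which $n$ tails (paths, each with at least one edge, attached at one endpoint to a cycle node) are attached; several tails may be attached to the same cycle node. *)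

(* Defs.v *)
From HB Require Import structures.
From mathcomp Require Import all_boot all_order all_algebra finmap.
From mathcomp Require Import all_classical all_reals all_analysis.

Set Implicit Arguments.
Unset Strict Implicit.
Unset Printing Implicit Defensive.

Import Order.TTheory GRing.Theory Num.Theory.

Local Open Scope ring_scope.
Local Open Scope fset_scope.
Local Open Scope classical_set_scope.

(* Node labels are natural numbers; [len u v] is [Some l] when u and v are joined
   by an edge of length l, and [None] when they are not adjacent. *)
Record graph (R : realType) := Graph {
  node : {fset nat};
  len : nat -> nat -> option R;
  len_sym : forall u v, len u v = len v u;
  len_irr : forall u, len u u = None;
  len_node : forall u v l, len u v = Some l -> u \in node;
  len_gt0 : forall u v l, len u v = Some l -> 0 < l;
  connected_graph : forall u v, u \in node -> v \in node ->
    exists2 p, path (fun x y => isSome (len x y)) u p & last u p = v }.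

Definition edge (R : realType) (G : graph R) : rel nat :=
  fun u v => isSome (len G u v).

(* [c] lists the cycle in cyclic order; a tail [t] is given by its attachment
   node [t.1] on the cycle and by the sequence [t.2] of its other nodes, in order
   of distance from [t.1]. Since the graph is simple, a cycle has at least three
   nodes. *)
Definition tadpole_link (c : seq nat) (ts : seq (nat * seq nat)) : rel nat :=
  fun u v => (u \in c) && (v == next c u) ||
             has (fun t => infix [:: u; v] (t.1 :: t.2)) ts.

Definition tadpole (R : realType) (n : nat) (G : graph R) : Prop :=
  exists (c : seq nat) (ts : seq (nat * seq nat)),
    [/\ (2 < size c)%N,
        size ts = n,
        all (fun t => (t.1 \in c) && (t.2 != [::])) ts,
        uniq (c ++ flatten [seq t.2 | t <- ts])
      & node G =i c ++ flatten [seq t.2 | t <- ts] /\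
        forall u v, edge G u v = tadpole_link c ts u v || tadpole_link c ts v u].

(* An agent either stands at node [dest] (when [remaining] is 0) or is traversing an edge
   towards [dest], which it reaches after a further time [remaining]. Edges are traversed
   completely, and [odo], the distance travelled, is charged at departure. *)
Record agent (R : realType) := Agent { dest : nat; remaining : R; odo : R }.

Record state (R : realType) (k : nat) := State {
  clock : R;
  agents : 'I_k -> agent R;
  visited : {fset nat} }.

(* Between two decisions every agent either waits or traverses an edge.
   [target d i] is the neighbour for which agent i leaves ([None]: it waits), and
   is ignored if i is inside an edge or if there is no such neighbour. The next
   decision is taken at the first arrival of an agent at a node, and at the latest
   after time [alarm d]. *)
Record decision (R : realType) (k : nat) := Decision {
  target : 'I_k -> option nat;
  alarm : {posnum R} }.

Definition depart (R : realType) (G : graph R) (w : option nat) (a : agent R) :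
    agent R :=
  if remaining a == 0 then
    if obind (len G (dest a)) w is Some l
    then Agent (odflt (dest a) w) l (odo a + l) else a
  else a.

Definition advance (R : realType) (dt : R) (a : agent R) : agent R :=
  Agent (dest a) (Num.max 0 (remaining a - dt)) (odo a).

Definition step (R : realType) (k : nat) (G : graph R) (d : decision R k)
    (st : state R k) : state R k :=
  let ag i := depart G (target d i) (agents st i) in
  let dt := \big[Num.min/(alarm d)%:num]_(i < k | 0 < remaining (ag i)) remaining (ag i) in
  let ag' i := advance dt (ag i) in
  State (clock st + dt) ag'
    (visited st `|` [fset dest (ag' i) | i in 'I_k & remaining (ag' i) == 0])%fset.

Definition init (R : realType) (k : nat) (s : nat) : state R k :=
  State 0 (fun=> Agent s 0 0) [fset s]%fset.

Definition revealed (R : realType) (G : graph R) (X : {fset nat}) :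
    nat -> nat -> option R :=
  fun u v => if (u \in X) || (v \in X) then len G u v else None.

Definition observation (R : realType) (k : nat) : Type :=
  (state R k * (nat -> nat -> option R))%type.

Definition observe (R : realType) (k : nat) (G : graph R) (st : state R k) :
    observation R k :=
  (st, revealed G (visited st)).

(* A strategy maps the observations made so far, latest first, to a decision. It
   knows the graph only through the revealed edges. *)
Definition strategy (R : realType) (k : nat) : Type :=
  seq (observation R k) -> decision R k.

Fixpoint run (R : realType) (k : nat) (sigma : strategy R k) (G : graph R)
    (s : nat) (j : nat) : state R k * seq (observation R k) :=
  if j is i.+1 then
    let: (st, h) := run sigma G s i in
    let st' := step G (sigma h) st in (st', observe G st' :: h)
  else (init R k s, [:: observe G (init R k s)]).

Definition finished (R : realType) (k : nat) (G : graph R) (s : nat)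
    (st : state R k) : bool :=
  (node G `<=` visited st)%fset &&
  [forall i, (dest (agents st i) == s) && (remaining (agents st i) == 0)].

Definition elapsed_time (R : realType) (k : nat) (st : state R k) : R := clock st.

Definition max_energy (R : realType) (k : nat) (st : state R k) : R :=
  \big[Num.max/0]_(i < k) odo (agents st i).

(* Both measures are nondecreasing along a run, so the infimum is the value at the
   first finished state; it is +oo when the exploration never finishes. *)
Definition cost (R : realType) (k : nat) (measure : state R k -> R)
    (sigma : strategy R k) (G : graph R) (s : nat) : \bar R :=
  ereal_inf [set (measure (run sigma G s j).1)%:E |
             j in [set j | finished G s (run sigma G s j).1]].

(* A plan fixes all decisions in advance; it may depend on G and s, which are known
   beforehand, and so does not need any observation. *)
Definition plan_strategy (R : realType) (k : nat) (plan : nat -> decision R k) :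
    strategy R k :=
  fun h => plan (size h).

Definition opt (R : realType) (k : nat) (measure : state R k -> R)
    (G : graph R) (s : nat) : \bar R :=
  ereal_inf [set cost measure (plan_strategy plan) G s |
             plan in [set: nat -> decision R k]].

Definition competitive_ratio (R : realType) (k : nat) (measure : state R k -> R)
    (C : graph R -> Prop) (sigma : strategy R k) : \bar R :=
  ereal_sup [set x | exists (G : graph R) (s : nat),
    [/\ C G, s \in node G
      & x = (cost measure sigma G s / opt measure G s)%E]].

(* Main.v *)
Require Import Defs.
From mathcomp Require Import all_boot all_order all_algebra finmap.
From mathcomp Require Import all_classical all_reals all_analysis.
From mathcomp Require Import zify lra.
Import Order.TTheory GRing.Theory Num.Theory.
Set Implicit Arguments.
Unset Strict Implicit.
Unset Printing Implicit Defensive.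
Local Open Scope ring_scope.

(* The strategy runs Dijkstra's algorithm with one agent moving at a time: the
   next node [v], with parent [u] in the shortest-path tree, is visited by the
   agent standing at [u], and otherwise by a fresh agent that walks down the tree
   from the root. When all nodes have been visited, all agents return to the root
   simultaneously along the tree. Every agent thus walks out to a single node and
   back, at most [2 D] for [D] the greatest distance from the root, and the total
   time is at most [(n + 2) D + D]; the optimum is at least [2 D] in both models.
   A fresh agent is needed only for a child of the root and for a further child of
   another node. The degree exceeds 2 by at most the number of tails attached to
   the node, so that [n + 2] agents suffice. The bounds are attained on a triangle
   with [n] pendant edges at the root, all edges having length 1. *)

(** * Agent moves and search trees *)

Lemma path_nth_take (T : Type) (e : rel T) (x0 p : T) (w : seq T) (j : nat) :
  path e p w -> (j < size w)%N -> e (last p (take j w)) (nth x0 w j).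
Proof.
move=> ew jw; move: ew.
by rewrite -{1}(cat_take_drop j w) cat_path (drop_nth x0 jw) /= => /and3P[].
Qed.

(* A move [(a, x)] sends agent [a] to the node [x]. *)
Definition position (s : nat) (ms : seq (nat * nat)) (a : nat) : nat :=
  last s [seq m.2 | m <- ms & m.1 == a].

Lemma position_cat_pair (s a i : nat) (ms : seq (nat * nat)) (w : seq nat) :
  position s (ms ++ [seq (a, x) | x <- w]) i =
  if i == a then last (position s ms i) w else position s ms i.
Proof.
rewrite /position filter_cat map_cat last_cat.
set p := last s _.
have [->|ia] := eqVneq i a.
  rewrite (_ : [seq m <- _ | _] = [seq (a, x) | x <- w]); last first.
    by apply/all_filterP/allP => m /mapP[x _ ->] /=.
  by rewrite -map_comp (eq_map (g := id)) ?map_id.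
rewrite (_ : [seq m <- _ | _] = [::]) //.
rewrite filter_map (eq_filter (a2 := pred0)) ?filter_pred0 // => x /=.
by rewrite eq_sym (negbTE ia).
Qed.

Lemma position_rcons (s : nat) (ms : seq (nat * nat)) (m : nat * nat) (i : nat) :
  position s (rcons ms m) i = if i == m.1 then m.2 else position s ms i.
Proof. by rewrite -cats1; case: m => a x; rewrite (position_cat_pair s a i ms [:: x]). Qed.

(* A search tree rooted at the start node: [found] lists the other nodes in the
   order of discovery, [route x] is the tree path from the root to [x] without
   the root, [posts] gives the current node of every agent that has left the
   root, and [moves] all edge traversals made so far. *)
Record tree (R : realType) := Tree {
  found : seq nat;
  label : nat -> R;
  parent : nat -> nat;
  route : nat -> seq nat;
  posts : seq nat;
  moves : seq (nat * nat) }.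

Definition weight (R : realType) (l : nat -> nat -> option R) (u v : nat) : R :=
  odflt 0 (l u v).

Definition frontier (R : realType) (l : nat -> nat -> option R) (s : nat)
    (T : tree R) (p : nat * nat) : Prop :=
  [/\ p.1 \in s :: found T, p.2 \notin s :: found T & l p.1 p.2 : bool].

Definition nearest (R : realType) (l : nat -> nat -> option R) (s : nat)
    (T : tree R) : set (nat * nat) :=
  [set p | frontier l s T p /\ forall q, frontier l s T q ->
     label T p.1 + weight l p.1 p.2 <= label T q.1 + weight l q.1 q.2].

(* If an agent stands at [u], then [index u (posts T)] is that agent; otherwise
   it is the first agent that has not left the root. *)
Definition extend (R : realType) (l : nat -> nat -> option R) (T : tree R)
    (u v : nat) : tree R :=
  let stands := u \in posts T in
  Tree (rcons (found T) v)
    [eta label T with v |-> label T u + weight l u v]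
    [eta parent T with v |-> u]
    [eta route T with v |-> rcons (route T u) v]
    (if stands then [seq if x == u then v else x | x <- posts T]
     else rcons (posts T) v)
    (moves T ++ [seq (index u (posts T), x) |
                 x <- if stands then [:: v] else rcons (route T u) v]).

(** [xget] breaks ties by a choice that depends only on the set [nearest], so two edge maps with the
    same nearest edges grow the tree alike. Without a frontier edge the tree is left as it is. *)
Definition grow (R : realType) (l : nat -> nat -> option R) (s : nat)
    (T : tree R) : tree R :=
  let p := xget (0, 0)%N (nearest l s T) in
  if `[< nearest l s T p >] then extend l T p.1 p.2 else T.

Definition grown (R : realType) (l : nat -> nat -> option R) (s N : nat) : tree R :=
  iter N (grow l s)
    (Tree [::] (fun=> 0) (fun=> s) (fun=> [::]) [::] [::]).

Definition children (R : realType) (T : tree R) (u : nat) : seq nat :=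
  [seq x <- found T | parent T x == u].

(** The invariant of Dijkstra's algorithm. By [label_frontier] nodes are found in order of distance,
    and by [label_edge] labels are 1-Lipschitz. In [size_posts] each child of the root costs one
    agent, while at any other node the first child is visited by the agent standing there; truncated
    subtraction gives 0 at leaves. *)
Record search_tree (R : realType) (G : graph R) (s : nat) (T : tree R) : Prop :=
    SearchTree {
  found_uniq : uniq (s :: found T);
  label_root : label T s = 0;
  parent_root : parent T s = s;
  route_root : route T s = [::];
  parent_found : forall x, x \in found T -> parent T x \in s :: found T;
  len_parent : forall x, x \in found T ->
    len G (parent T x) x = Some (label T x - label T (parent T x));
  label_edge : forall u v l, u \in s :: found T -> v \in s :: found T ->
    len G u v = Some l -> label T v <= label T u + l;
  label_frontier : forall x u v l, x \in s :: found T -> u \in s :: found T ->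
    v \notin s :: found T -> len G u v = Some l -> label T x <= label T u + l;
  route_found : forall x, x \in found T ->
    route T x = rcons (route T (parent T x)) x;
  route_sub : forall x, x \in s :: found T -> {subset route T x <= found T};
  route_last : forall x, x \in s :: found T -> last s (route T x) = x;
  route_path : forall x, x \in s :: found T ->
    path (fun a b => parent T b == a) s (route T x);
  posts_uniq : uniq (posts T);
  posts_sub : {subset posts T <= found T};
  posts_leaf : forall x, x \in found T -> (x \in posts T) = nilp (children T x);
  size_posts :
    size (posts T) = (\sum_(u <- node G) (size (children T u) - (u != s)))%N;
  position_moves : forall a, position s (moves T) a = nth s (posts T) a;
  movesP : forall j, (j < size (moves T))%N ->
    let m := nth (0, 0)%N (moves T) j in
    [/\ m.2 \in found T, parent T m.2 = position s (take j (moves T)) m.1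
      & (m.1 < size (posts T))%N];
  found_moves : {subset found T <= [seq m.2 | m <- moves T]} }.

(** * Adding the nearest node preserves the invariant *)

Section Extend.
Context (R : realType) (G : graph R) (s : nat) (T : tree R) (u v : nat).
Hypotheses (sT : search_tree G s T) (uv : nearest (len G) s T (u, v)).
Let T' := extend (len G) T u v.

Let vT : v \notin s :: found T. Proof. by case: uv => -[]. Qed.
Let uT : u \in s :: found T. Proof. by case: uv => -[]. Qed.
Let uG : u \in node G.
Proof. by case: uv => -[_ _ /=]; case E: (len G u v) => // _ _; exact: len_node E. Qed.
Let luv : len G u v = Some (weight (len G) u v).
Proof. by case: uv => -[_ _ /=]; rewrite /weight; case: (len G u v). Qed.
Let neqv x : x \in s :: found T -> (x == v) = false.
Proof. by move=> xT; apply/eqP => xv; move: vT; rewrite -xv xT. Qed.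
Let memT' x : (x \in s :: found T') = (x == v) || (x \in s :: found T).
Proof. by rewrite /= !inE mem_rcons inE; case: (x == s); case: (x == v). Qed.
Let foundT' x : (x \in found T') = (x == v) || (x \in found T).
Proof. by rewrite /= mem_rcons inE. Qed.
Let subT x : x \in found T -> x \in s :: found T.
Proof. by rewrite inE orbC => ->. Qed.
Let vmin x y l : x \in s :: found T -> y \notin s :: found T ->
  len G x y = Some l -> label T u + weight (len G) u v <= label T x + l.
Proof.
move=> xT yT xy; case: uv => _ /(_ (x, y)) /=.
by rewrite {2}/weight xy /=; apply; split => //=; rewrite xy.
Qed.

Let label_new x : x \in s :: found T -> label T x <= label T u + weight (len G) u v.
Proof. by move=> xT; exact: label_frontier uT vT luv. Qed.

Let children_extend x : size (children T' x) = ((u == x) + size (children T x))%N.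
Proof.
rewrite /children /= filter_rcons /= eqxx.
have -> : [seq y <- found T | (if y == v then u else parent T y) == x] =
          [seq y <- found T | parent T y == x].
  by apply: eq_in_filter => y /subT /neqv ->.
by case: (u == x); rewrite ?size_rcons.
Qed.

Let childless x : x \notin s :: found T -> children T x = [::].
Proof.
move=> xT; apply/eqP; rewrite -[_ == _]negbK -has_filter; apply/hasPn => y yT.
by apply/eqP => yx; move: xT; rewrite -yx (parent_found sT).
Qed.

Let posts_new : posts T' = if u \in posts T then [seq if x == u then v else x | x <- posts T]
  else rcons (posts T) v. Proof. by []. Qed.

Let size_postsT' : size (posts T') = (size (posts T) + (u \notin posts T))%N.
Proof. by rewrite posts_new; case: ifP => _; rewrite ?size_map ?size_rcons ?addn0 ?addn1. Qed.

Let us_posts : (u \in posts T) = (u != s) && nilp (children T u).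
Proof.
have [->|us] := eqVneq u s => /=.
  by apply/negP => /(posts_sub sT) sf; case/andP: (found_uniq sT); rewrite sf.
by apply: (posts_leaf sT); move: uT; rewrite inE (negbTE us).
Qed.

Let vposts : v \notin posts T.
Proof. by apply: contra vT => /(posts_sub sT) /subT. Qed.

Let mem_postsT' x : (x \in posts T') = (x == v) || (x \in posts T) && (x != u).
Proof.
rewrite posts_new; case: ifPn => ups; last first.
  rewrite mem_rcons inE.
  by case: (eqVneq x u) => [->|_]; rewrite ?(negbTE ups) ?andbT.
apply/idP/idP => [/mapP[y yp ->]|].
  by case: ifPn => yu; rewrite ?eqxx // yp yu orbT.
case/orP => [/eqP->|/andP[xp xu]]; apply/mapP; first by exists u; rewrite ?eqxx.
by exists x; rewrite // (negbTE xu).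
Qed.

(** Minimality of the edge from [u] to [v] yields both label conditions. No agent stands at [u]
    exactly when [u] is the root or already has a child, and these are the cases in which the term
    of [u] in [size_posts] grows. *)
Lemma search_tree_extend : search_tree G s T'.
Proof.
have [T_s T_0 T_ps T_r0 T_p T_l T_e T_f T_r T_rs T_rl T_rp T_pu T_pS T_pl T_sz T_pm T_m T_fm] := sT.
have sTs : s \in s :: found T by rewrite inE eqxx.
have sv := neqv sTs.
have uv' := neqv uT.
split.
- move: vT T_s; rewrite /= rcons_uniq mem_rcons !inE sv negb_or /=.
  by move=> /andP[_ ->] /andP[-> ->].
- by rewrite /= sv.
- by rewrite /= sv.
- by rewrite /= sv.
- move=> x; rewrite foundT' memT'.
  have [->|xv] := eqVneq x v => /= xT; first by rewrite eqxx uT orbT.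
  by rewrite (negbTE xv) T_p ?orbT.
- move=> x; rewrite foundT' /=.
  have [->|xv] := eqVneq x v => /= xT.
    by rewrite uv' luv; congr Some; lra.
  by rewrite (neqv (T_p _ xT)) T_l.
(* An edge from an old node to [v] is a frontier edge, so [vmin] applies; in the other direction the
   old label is already at most that of [v]. *)
- move=> x y l; rewrite !memT' /=.
  have [->|xv] := eqVneq x v; have [->|yv] := eqVneq y v => //= xT yT.
  + by rewrite len_irr.
  + by move=> xy; have := len_gt0 xy; have := label_new yT; lra.
  + by move=> xy; exact: vmin xy.
  + exact: T_e.
- move=> x y z l; rewrite !memT' /= negb_or.
  have [->|xv] := eqVneq x v; have [->|yv] := eqVneq y v => //= xT yT /andP[zv zT] yz.
  + by have := len_gt0 yz; lra.
  + exact: vmin yz.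
  + by have := len_gt0 yz; have := label_new xT; lra.
  + exact: T_f yz.
- move=> x; rewrite foundT' /=.
  have [->|xv] := eqVneq x v => /= xT; first by rewrite uv'.
  by rewrite (neqv (T_p _ xT)) T_r.
- move=> x; rewrite memT' /=.
  have [_ _ y|xv /= xT y] := eqVneq x v; rewrite foundT'.
    by rewrite mem_rcons inE => /orP[->//|/T_rs ->//]; rewrite orbT.
  by move=> /T_rs ->; rewrite ?orbT.
- move=> x; rewrite memT' /=.
  by have [->|xv /= /T_rl//] := eqVneq x v; rewrite last_rcons.
- have keep x : x \in s :: found T ->
      path (fun a b => parent T' b == a) s (route T x).
    move=> xT; rewrite (@eq_in_path _ (predC1 v) _ (fun a b => parent T b == a)) ?T_rp //.
      by move=> a b _ /=; rewrite inE /= => /negbTE ->.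
    rewrite /= sv /=; apply/allP => y /(T_rs _ xT) /subT /neqv.
    by rewrite /= => ->.
  move=> x; rewrite memT' /=.
  have [->|xv /= xT] := eqVneq x v; last exact: keep.
  by move=> _; rewrite rcons_path keep //= eqxx T_rl.
- rewrite posts_new; case: ifPn => ups; last by rewrite rcons_uniq vposts.
  rewrite map_inj_in_uniq // => x y xp yp.
  have [->|xu] := eqVneq x u; have [->|yu] := eqVneq y u => // E.
    by move: vposts; rewrite E yp.
  by move: vposts; rewrite -E xp.
- move=> x; rewrite mem_postsT' foundT' => /orP[->//|/andP[/T_pS -> _]].
  by rewrite orbT.
- move=> x; rewrite foundT' mem_postsT' /nilp children_extend addn_eq0.
  have [-> _|xv /= xT] := eqVneq x v.
    by rewrite uv' /= childless.
  by rewrite T_pl // /nilp andbC eq_sym; case: (u == x).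
(* Only the term of [u] changes: by 1, or by 0 if [u] is a childless node other than the root, where
   [0 - 1] and [1 - 1] are both 0. *)
- rewrite size_postsT' T_sz !(bigD1_seq u) ?fset_uniq //= children_extend eqxx.
  rewrite [in RHS](eq_bigr (fun x => size (children T x) - (x != s))%N); last first.
    by move=> x xu; rewrite children_extend eq_sym (negbTE xu).
  set rest := (\sum_(_ <- _ | _) _)%N.
  rewrite us_posts /nilp; move: (size (children T u)) rest => k rest.
  by case: (u == s); case: k => [|k] /=; lia.
- move=> a; rewrite position_cat_pair T_pm posts_new.
  case: (boolP (u \in posts T)) => ups.
    have [->|ai] := eqVneq a (index u (posts T)).
      by rewrite (nth_map s) ?index_mem //= nth_index // eqxx.
    have [asz|asz] := ltnP a (size (posts T)); last by rewrite !nth_default ?size_map.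
    rewrite (nth_map s) //; case: eqP => // au.
    by move: ai; rewrite -au index_uniq ?eqxx.
  rewrite nth_rcons memNindex // last_rcons.
  by have [//|asz|//] := ltngtP a (size (posts T)); rewrite nth_default // ltnW.
- move=> j; rewrite size_cat size_map.
  set w := (if u \in posts T then _ else _).
  have w_found x : x \in w -> x \in found T'.
    rewrite foundT' /w; case: ifP => _; first by rewrite inE => ->.
    by rewrite mem_rcons inE => /orP[->//|/T_rs -> //]; rewrite orbT.
  (* If no agent stands at [u], then [index u (posts T)] is the size of [posts T], so the default
     value of [nth] places this agent at the root. *)
  have w_path : path (fun a b => parent T' b == a) (position s (moves T) (index u (posts T))) w.
    rewrite T_pm /w; case: ifPn => ups; first by rewrite /= eqxx nth_index // eqxx.
    rewrite memNindex // nth_default // rcons_path /= eqxx T_rl // eqxx andbT.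
    rewrite (@eq_in_path _ (predC1 v) _ (fun a b => parent T b == a)) ?T_rp //.
      by move=> a b _ /=; rewrite inE /= => /negbTE ->.
    rewrite /= sv /=; apply/allP => y /(T_rs _ uT) /subT /neqv.
    by rewrite /= => ->.
  have [jT _|jT] := ltnP j (size (moves T)).
    rewrite /T' /= nth_cat jT takel_cat ?(ltnW jT) //.
    have [xT mx asz] := T_m _ jT.
    split; first by rewrite mem_rcons inE xT orbT.
      by rewrite (neqv (subT xT)).
    by move: size_postsT'; rewrite /T' /= => ->; rewrite ltn_addr.
  rewrite -(subnKC jT) ltn_add2l => jw.
  rewrite /T' /= nth_cat ltnNge leq_addr /= addKn (nth_map 0%N) //=.
  have -> : take (size (moves T) + (j - size (moves T)))
         (moves T ++ [seq (index u (posts T), x) | x <- w])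
     = moves T ++ [seq (index u (posts T), x) | x <- take (j - size (moves T)) w].
    by rewrite take_cat ltnNge leq_addr /= addKn map_take.
  split.
  + by have := w_found _ (mem_nth 0%N jw); rewrite /T'.
  + by rewrite position_cat_pair eqxx; have /eqP := path_nth_take 0%N w_path jw.
  + by move: size_postsT'; rewrite /T' /= => ->; case: (boolP (u \in posts T)) => ups;
      rewrite ?addn0 ?addn1 ?index_mem ?ltnS ?index_size.
- move=> x; rewrite foundT' /= map_cat mem_cat -map_comp => /orP[/eqP->|/T_fm -> //].
  apply/orP; right; rewrite (eq_map (g := id)) // map_id.
  by case: ifP; rewrite ?mem_rcons inE eqxx.
Qed.

End Extend.

(** * Growing the tree to completion *)

Lemma seq_argmin (R : realType) (T : eqType) (f : T -> R) (x : T) (r : seq T) :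
  x \in r -> exists2 y, y \in r & forall z, z \in r -> f y <= f z.
Proof.
elim: r x => // a [|b r] IH x _.
  by exists a; rewrite ?mem_head // => z; rewrite inE => /eqP ->.
have [y yr ymin] := IH b (mem_head b r).
have [ay|ya] := leP (f a) (f y).
  exists a; first exact: mem_head.
  by move=> z; rewrite inE => /orP[/eqP ->//|/ymin]; apply: le_trans.
exists y; first by rewrite inE yr orbT.
by move=> z; rewrite inE => /orP[/eqP ->|/ymin//]; exact: ltW.
Qed.

Lemma prefix_moves_grow (R : realType) (l : nat -> nat -> option R) (s : nat) (T : tree R) :
  prefix (moves T) (moves (grow l s T)).
Proof. by rewrite /grow; case: ifP => _; rewrite ?prefix_refl ?prefix_prefix. Qed.

Lemma prefix_moves_grown (R : realType) (l : nat -> nat -> option R) (s N N' : nat) :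
  (N <= N')%N -> prefix (moves (grown l s N)) (moves (grown l s N')).
Proof.
move/subnK <-; elim: (N' - N)%N => [|k IH]; first exact: prefix_refl.
by apply: prefix_trans IH _; exact: prefix_moves_grow.
Qed.

(** A growth step inspects only edges at nodes already found, so it does the same on the revealed
    part of the graph as on the whole graph once these nodes have been visited. *)
Lemma eq_grow (R : realType) (l l' : nat -> nat -> option R) (s : nat) (T : tree R) :
  (forall u v, u \in s :: found T -> l' u v = l u v) -> grow l' s T = grow l s T.
Proof.
move=> ll'; rewrite /grow.
have fr q : frontier l' s T q <-> frontier l s T q.
  by split=> -[qT q2 h]; split => //; move: h; rewrite ll'.
have wE q : frontier l s T q -> weight l' q.1 q.2 = weight l q.1 q.2.
  by case=> qT _ _; rewrite /weight ll'.
have -> : nearest l' s T = nearest l s T.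
  apply/seteqP; split=> p [pT pmin].
    by have {}pT := (fr p).1 pT; split=> // q qT; rewrite -!wE //; apply/pmin/fr.
  split; first exact/fr.
  by move=> q /fr qT; rewrite !wE //; exact: pmin.
case: ifP => // /asboolP [[pT _ _] _]; congr Tree.
by rewrite /weight ll'.
Qed.

Section Growth.
Context (R : realType) (G : graph R) (s : nat).
Hypothesis sG : s \in node G.

Definition complete (T : tree R) : Prop := {subset node G <= s :: found T}.

Lemma search_tree_root : search_tree G s (grown (len G) s 0).
Proof.
have inroot x : x \in [:: s] -> x = s by rewrite inE => /eqP.
split=> //=.
- by move=> u v l /inroot -> /inroot ->; rewrite len_irr.
- by move=> x u v l _ _ _ /len_gt0; rewrite add0r => /ltW.
- by move=> x /inroot ->.
- by rewrite big1_seq.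
- by move=> a; rewrite nth_nil.
Qed.

Lemma found_node (T : tree R) : search_tree G s T -> {subset s :: found T <= node G}.
Proof.
move=> sT x; rewrite inE => /orP[/eqP ->//|/(len_parent sT)].
by rewrite len_sym; exact: len_node.
Qed.

(** The pairs of nodes are finitely many, so a nonempty frontier has a nearest edge. With an empty
    frontier, connectedness carries membership in the tree from the root along a path to every
    node. *)
Lemma growP (T : tree R) : search_tree G s T ->
  (complete T /\ grow (len G) s T = T) \/
  exists u v, nearest (len G) s T (u, v) /\ grow (len G) s T = extend (len G) T u v.
Proof.
move=> sT; rewrite /grow; case: ifPn => [/asboolP|/asboolP none].
  set p := xget _ _; case: p => u v uv; right; exists u, v; split => //.
left; split => //.
have nofront p : ~ frontier (len G) s T p.
  move=> pT.
  pose r := [seq q <- [seq (u, v) | u <- node G, v <- node G] | `[< frontier (len G) s T q >]].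
  have inr q : frontier (len G) s T q -> q \in r.
    move=> qT; rewrite mem_filter; apply/andP; split; first exact/asboolP.
    case: q qT => u v [uT vT /=]; case E: (len G u v) => [l|//] _.
    apply/allpairsP; exists (u, v); split => //=; first exact: len_node E.
    by move: E; rewrite len_sym; exact: len_node.
  have [q] := seq_argmin (fun q => label T q.1 + weight (len G) q.1 q.2) (inr p pT).
  rewrite mem_filter => /andP[/asboolP qT _] qmin.
  apply: none; have : nearest (len G) s T q by split=> // q' /inr /qmin.
  exact: xgetI.
move=> x xG; have [w + <-] := connected_graph sG xG.
elim/last_ind: w => [|w y IH]; first by rewrite mem_head.
rewrite last_rcons rcons_path => /andP[/IH wT wy].
by apply/negP => /negP yT; apply: (nofront (last s w, y)).
Qed.

Lemma search_tree_grown (N : nat) : search_tree G s (grown (len G) s N).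
Proof.
elim: N => [|N IH]; first exact: search_tree_root.
have [[_ E]|[u [v [uv E]]]] := growP IH; rewrite /grown iterS E //.
exact: search_tree_extend.
Qed.

(** A round on an incomplete tree adds one node and at least one move. Thus [N] rounds determine the
    first [N] moves, unless the search ends earlier. *)
Lemma grown_complete_or (N : nat) : complete (grown (len G) s N) \/
  size (found (grown (len G) s N)) = N /\ (N <= size (moves (grown (len G) s N)))%N.
Proof.
elim: N => [|N IH]; first by right.
have [[cT E]|[u [v [uv E]]]] := growP (search_tree_grown N).
  by left; rewrite /grown iterS E.
right; rewrite /grown iterS E /= size_rcons size_cat size_map.
case: IH => [cT|[-> leN]].
  case: uv => -[_ /negP vT /=]; case E': (len G u v) => [l|//] _ _.
  by case: vT; apply: cT; move: E'; rewrite len_sym; exact: len_node.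
split => //; apply: leq_ltn_trans leN _; rewrite -[X in (X < _)%N]addn0 ltn_add2l.
by case: ifP; rewrite ?size_rcons.
Qed.

Definition spanning : tree R := grown (len G) s #|` node G|.

Lemma search_tree_spanning : search_tree G s spanning.
Proof. exact: search_tree_grown. Qed.

Lemma complete_spanning : complete spanning.
Proof.
have [//|[szE _]] := grown_complete_or #|` node G|.
have := uniq_leq_size (found_uniq search_tree_spanning) (found_node search_tree_spanning).
by rewrite /= szE ltnn.
Qed.

Lemma grown_spanning (N : nat) :
  complete (grown (len G) s N) -> grown (len G) s N = spanning.
Proof.
have stop k M : complete (grown (len G) s M) -> grown (len G) s (k + M) = grown (len G) s M.
  move=> cM; elim: k => // k IH; rewrite /grown addSn iterS -/(grown _ _ _) IH.
  have [[_ //]|[u [v [[[_ /negP vT /=] + _] _]]]] := growP (search_tree_grown M).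
  case E': (len G u v) => [l|//] _.
  by case: vT; apply: cM; move: E'; rewrite len_sym; exact: len_node.
move=> cN; have [leN|/ltnW leN] := leqP N #|` node G|.
  by rewrite /spanning -(subnK leN) stop.
by rewrite -(subnK leN) stop //; exact: complete_spanning.
Qed.

Lemma prefix_moves_spanning (N : nat) :
  prefix (moves (grown (len G) s N)) (moves spanning).
Proof.
have [leN|/ltnW leN] := leqP N #|` node G|; first exact: prefix_moves_grown.
rewrite grown_spanning ?prefix_refl //.
have [//|[szE _]] := grown_complete_or N.
have := uniq_leq_size (found_uniq (search_tree_grown N)) (found_node (search_tree_grown N)).
by rewrite /= szE ltnNge leN.
Qed.

(* Until its [j]-th move the search has only used edges at nodes that have been
   visited by the first [j] moves. *)
Lemma grown_revealed (X : {fset nat}) (j : nat) :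
  s \in X -> {subset [seq m.2 | m <- take j (moves spanning)] <= X} ->
  let T := grown (revealed G X) s j.+1 in
  if (j < size (moves spanning))%N
  then (j < size (moves T))%N /\
    nth (0, 0)%N (moves T) j = nth (0, 0)%N (moves spanning) j
  else T = spanning.
Proof.
move=> sX subX; set l' := revealed G X; set T := grown l' s j.+1 => /=.
(* The searches on the revealed and on the whole graph agree for all [N] rounds, or at least up to a
   round that already contains the [j]-th move; they may diverge only afterwards. *)
have local N : grown l' s N = grown (len G) s N \/ exists i, [/\ (i <= N)%N,
    (j < size (moves (grown (len G) s i)))%N & grown l' s i = grown (len G) s i].
  elim: N => [|N [IH|[i [iN ji E]]]]; first by left.
    have [jN|Nj] := ltnP j (size (moves (grown (len G) s N))).
      by right; exists N.
    left; rewrite /grown !iterS -!/(grown _ _ _) IH; apply: eq_grow => u v uT.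
    suff uX : u \in X by rewrite /l' /revealed uX.
    move: uT; rewrite inE => /orP[/eqP ->//|].
    move/(found_moves (search_tree_grown N)) => uT; apply: subX.
    have /prefixP[w ->] := prefix_moves_spanning N.
    by rewrite take_cat ltnNge Nj /= map_cat mem_cat uT.
  by right; exists i; split=> //; rewrite ltnW.
have before i : (j < size (moves (grown (len G) s i)))%N ->
    (j < size (moves spanning))%N /\
    nth (0, 0)%N (moves (grown (len G) s i)) j = nth (0, 0)%N (moves spanning) j.
  move=> ji; have /prefixP[w ->] := prefix_moves_spanning i.
  by rewrite nth_cat ji size_cat ltn_addr.
have [E|[i [iN ji E]]] := local j.+1.
  rewrite /T E; have [cT|[_ jT]] := grown_complete_or j.+1.
    by rewrite (grown_spanning cT); case: ifP.
  by have [-> ->] := before _ jT.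
have [-> <-] := before _ ji.
have /prefixP[w] := prefix_moves_grown l' s iN.
by rewrite -/T E => ->; rewrite nth_cat ji size_cat ltn_addr.
Qed.

End Growth.

(** * Lower bound for every exploration, by a 1-Lipschitz potential *)

Section LowerBound.
Context (R : realType) (k : nat) (G : graph R) (s : nat) (phi : nat -> R).
Hypotheses (phi_s : phi s = 0)
  (phi_edge : forall u v l, len G u v = Some l -> phi v <= phi u + l).

(** An agent arriving at [v] has walked at least [phi v], so its odometer plus potential is then at
    least [2 * phi v]. This sum never decreases, since an edge lowers the potential by at most its
    length; back at [s], where [phi] vanishes, the odometer alone satisfies the bound. Subtracting
    [remaining] compensates for charging an edge at departure. *)
Let tracked (st : state R k.+1) : Prop :=
  [/\ forall i, odo (agents st i) - remaining (agents st i) <= clock st,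
      forall i, phi (dest (agents st i)) <= odo (agents st i)
    & forall v, v \in visited st ->
        exists i, 2 * phi v <= odo (agents st i) + phi (dest (agents st i))].

Let tracked_step (d : decision R k.+1) (st : state R k.+1) :
  tracked st -> tracked (step G d st).
Proof.
move=> [clk near vis].
pose b i := depart G (target d i) (agents st i).
have bP i : [/\ odo (b i) - remaining (b i) <= clock st, phi (dest (b i)) <= odo (b i)
    & odo (agents st i) + phi (dest (agents st i)) <= odo (b i) + phi (dest (b i))].
  have := clk i; have := near i; rewrite /b /depart.
  case: eqP => [rem0|_]; last by split.
  case: (target d i) => [w|] /=; last by split.
  case E: (len G _ w) => [l|]; last by split.
  have := phi_edge E; move: E; rewrite len_sym => /phi_edge /=; rewrite rem0.
  by move=> *; split; lra.
rewrite /step -/b; set dt := \big[_/_]_(_ < _ | _) _.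
split=> /= [i|i|v].
- have [h _ _] := bP i; have : remaining (b i) - dt <= Num.max 0 (remaining (b i) - dt).
    by rewrite le_max lexx orbT.
  by lra.
- by have [] := bP i.
- rewrite in_fsetU => /orP[/vis[i iv]|/imfsetP[i _ /= ->]]; exists i; have [_ h1 h2] := bP i.
    exact: le_trans iv h2.
  by rewrite mulr2n mulrDl mul1r lerD2r.
Qed.

Lemma finished_lower (sigma : strategy R k.+1) (j : nat) (v : nat) :
  let st := (run sigma G s j).1 in v \in node G -> finished G s st ->
  2 * phi v <= max_energy st /\ 2 * phi v <= elapsed_time st.
Proof.
move=> st vG /andP[/fsubsetP/(_ _ vG) vst /forallP home].
have [clk near vis] : tracked st.
  rewrite /st; elim: j {st vst home} => [|j] /=.
    split=> [i|i|x] /=; rewrite ?phi_s ?subrr //.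
    by rewrite inE => /eqP ->; exists ord0; rewrite phi_s mulr0 addr0.
  by case: (run sigma G s j) => st h /=; exact: tracked_step.
have [i iv] := vis v vst; have /andP[/eqP si /eqP ri] := home i.
move: iv; rewrite si phi_s addr0 => iv; split.
  by apply: (le_trans iv); exact: (le_bigmax _ (fun i => odo (agents st i)) i).
by apply: (le_trans iv); have := clk i; rewrite ri subr0.
Qed.

End LowerBound.

(** * Histories, alarms and single moves in the execution model *)

Lemma revealed_in (R : realType) (G : graph R) (X : {fset nat}) (u v : nat) :
  u \in X -> revealed G X u v = len G u v.
Proof. by rewrite /revealed => ->. Qed.

(** This lets the strategy recover the round number and the start node from its history. *)
Lemma run_history (R : realType) (k : nat) (sigma : strategy R k) (G : graph R)
    (s j : nat) : exists h,
  [/\ (run sigma G s j).2 = observe G (run sigma G s j).1 :: h, size h = j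
    & last (observe G (run sigma G s j).1) h = observe G (init R k s)].
Proof.
elim: j => [|j [h [E szh lh]]] /=; first by exists [::].
case: (run sigma G s j) E lh => st h' /= -> lh.
by exists (observe G st :: h); rewrite /= szh.
Qed.

(* The alarm exceeds the duration of every traversal, so that it never rings
   before an arrival. *)
Definition patient (R : realType) (k : nat) (o : observation R k)
    (t : 'I_k -> option nat) : decision R k :=
  Decision t (`|\sum_i (`|remaining (agents o.1 i)| +
    `|odflt 0 (obind (o.2 (dest (agents o.1 i))) (t i))|)| + 1)%:pos.

(** An agent able to depart stands at a visited node, so the length of its next edge is revealed and
    is a summand of the alarm. *)
Lemma depart_le_alarm (R : realType) (k : nat) (G : graph R) (st : state R k)
    (t : 'I_k -> option nat) (i : 'I_k) :
  (remaining (agents st i) = 0 -> dest (agents st i) \in visited st) ->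
  remaining (depart G (t i) (agents st i)) <=
  (alarm (patient (observe G st) t))%:num.
Proof.
move=> vis.
pose f i := `|remaining (agents st i)| +
  `|odflt 0 (obind (revealed G (visited st) (dest (agents st i))) (t i))|.
have f0 j : 0 <= f j by rewrite addr_ge0.
have fi : f i <= \sum_j f j by rewrite (bigD1 i) //= lerDl sumr_ge0.
have : \sum_j f j <= `|\sum_j f j| + 1 by rewrite (le_trans (ler_norm _)) ?lerDl.
apply: le_trans; apply: le_trans fi.
rewrite /f /depart; case: eqP => [/[dup] /vis v0 r0|_]; last first.
  by rewrite (le_trans (ler_norm _)) ?lerDl.
case: (t i) => [w|] /=; last by rewrite (le_trans (ler_norm _)) ?lerDl.
rewrite revealed_in //; case: (len G _ w) => [l|] /=; last first.
  by rewrite (le_trans (ler_norm _)) ?lerDl.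
by rewrite (le_trans (ler_norm _)) ?lerDr.
Qed.

(** Waiting agents do not enter the minimum that defines the duration, so the step lasts exactly one
    traversal. *)
Lemma step_one_agent (R : realType) (k : nat) (G : graph R) (d : decision R k)
    (st : state R k) (a : 'I_k) (x : nat) (l : R) :
  (forall i, remaining (agents st i) = 0) ->
  target d =1 (fun i => if i == a then Some x else None) ->
  len G (dest (agents st a)) x = Some l -> l <= (alarm d)%:num ->
  [/\ clock (step G d st) = clock st + l,
      forall i, agents (step G d st) i =
        if i == a then Agent x 0 (odo (agents st a) + l) else agents st i
    & forall y, (y \in visited (step G d st)) = (y \in visited st) ||
        [exists i, dest (agents (step G d st) i) == y]].
Proof.
move=> rem0 td ax la.
have l0 := len_gt0 ax.
have dep i : depart G (target d i) (agents st i) =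
    if i == a then Agent x l (odo (agents st a) + l) else agents st i.
  rewrite /depart rem0 eqxx td; case: eqP => [->|//] /=; by rewrite ax.
rewrite /step; set dt := \big[_/_]_(_ < _ | _) _.
have dtl : dt = l.
  apply/le_anti/andP; split.
    have a0 : 0 < remaining (depart G (target d a) (agents st a)) by rewrite dep eqxx.
    have := @bigmin_le_cond _ _ _ (alarm d)%:num a
      (fun i => 0 < remaining (depart G (target d i) (agents st i)))
      (fun i => remaining (depart G (target d i) (agents st i))) a0.
    by rewrite -/dt dep eqxx.
  apply: le_bigmin => // i; rewrite dep; case: eqP => //= _.
  by rewrite rem0 ltxx.
have adv i : advance dt (depart G (target d i) (agents st i)) =
    if i == a then Agent x 0 (odo (agents st a) + l) else agents st i.
  rewrite dep dtl /advance; case: eqP => _ /=; first by rewrite subrr maxxx.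
  have := rem0 i; case: (agents st i) => p r o /= ->.
  by rewrite sub0r max_l // oppr_le0 ltW.
split=> /=; [by rewrite dtl | exact: adv |].
move=> y; rewrite in_fsetU; congr (_ || _); apply/imfsetP/existsP => /=.
  by move=> [i _ ->]; exists i.
move=> [i /eqP <-]; exists i => //; rewrite !inE /=.
change (remaining (advance dt (depart G (target d i) (agents st i))) == 0).
by rewrite adv; case: (i == a); rewrite /= ?rem0 eqxx.
Qed.

(** * The strategy and its two phases *)

Section Strategy.
Context (R : realType) (n : nat).

(** The search is recomputed from the revealed edges in every round; [j.+1] growth rounds are enough
    to know move number [j], counted from 0. In the return phase an agent at the root is sent to its
    parent, the root itself, and hence waits, because there are no loops. *)
Definition sequential_order (s j : nat) (o : observation R n.+2) : decision R n.+2 :=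
  let T := grown o.2 s j.+1 in
  let m := nth (0, 0)%N (moves T) j in
  patient o (fun i => if (j < size (moves T))%N
                      then if i == m.1 :> nat then Some m.2 else None
                      else Some (parent T (dest (agents o.1 i)))).

(* The agents start at [s], so the oldest observation reveals [s]. *)
Definition sequential : strategy R n.+2 := fun h =>
  if h is o :: h' then
    sequential_order (dest (agents (last o h').1 ord0)) (size h') o
  else Decision (fun=> None) 1%:pos.

Lemma run_sequentialS (G : graph R) (s j : nat) :
  let st := (run sequential G s j).1 in
  (run sequential G s j.+1).1 = step G (sequential_order s j (observe G st)) st.
Proof.
have [h [+ szh lh]] := run_history sequential G s j => /=.
case: (run sequential G s j) lh => st h' /= lh ->.
by rewrite /sequential lh szh.
Qed.

End Strategy.

Section Execution.
Context (R : realType) (n : nat) (G : graph R) (s : nat).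
Hypothesis sG : s \in node G.
Let F := spanning G s.
Hypothesis posts_n : (size (posts F) <= n.+2)%N.
Let st j := (run (@sequential R n) G s j).1.
Let sF : search_tree G s F. Proof. exact: search_tree_spanning. Qed.
Let allF : {subset node G <= s :: found F}. Proof. exact: complete_spanning. Qed.

Let moves_found j : {subset [seq m.2 | m <- take j (moves F)] <= found F}.
Proof.
move=> x /mapP[m /mem_take /(nthP (0, 0)%N)[i isz <-] ->].
by have [] := movesP sF isz.
Qed.

Lemma label_ge0 (x : nat) : x \in s :: found F -> 0 <= label F x.
Proof.
have [k] := ubnP (size (route F x)); elim: k x => // k IH x szx.
rewrite inE => /orP[/eqP ->|xF]; first by rewrite (label_root sF).
have := IH (parent F x); have := len_gt0 (len_parent sF xF).
move: szx; rewrite (route_found sF xF) size_rcons ltnS => szx.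
by move=> h /(_ szx (parent_found sF xF)); lra.
Qed.

(** Agents walk down tree paths only, so odometers equal labels; they move one at a time, so the
    clock is the sum of the odometers. *)
Definition outbound (j : nat) (S : state R n.+2) : Prop :=
  [/\ forall i : 'I_n.+2, let p := position s (take j (moves F)) i in
        agents S i = Agent p 0 (label F p),
      visited S =i s :: [seq m.2 | m <- take j (moves F)]
    & clock S = \sum_i odo (agents S i)].

(** The second claim bounds the time from below by the number of moves; it serves for the extremal
    example, with [c = 1]. *)
Lemma run_outbound (j : nat) : (j <= size (moves F))%N ->
  outbound j (st j) /\
  forall c, (forall u v l, len G u v = Some l -> c <= l) -> c *+ j <= clock (st j).
Proof.
elim: j => [_|j IH jJ].
  rewrite /st /=; split; last by move=> c _; rewrite mulr0n.
  split=> /= [i|x|]; rewrite ?take0 /= ?(label_root sF) //.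
    by rewrite !inE.
  by rewrite big1.
have [[ag vis clk] units] := IH (ltnW jJ).
have svis : s \in visited (st j) by rewrite vis mem_head.
have mvis : {subset [seq m.2 | m <- take j (moves F)] <= visited (st j)}.
  by move=> x xm; rewrite vis inE xm orbT.
(* All nodes reached by the first [j] moves are visited, so the revealed edges determine the next
   move. *)
have := grown_revealed sG svis mvis; rewrite /= jJ => -[jT nthT].
have [] := movesP sF jJ.
set m := nth _ _ _ => m2 mpar /leq_trans/(_ posts_n) m1.
pose a := Ordinal m1.
set o := sequential_order s j (observe G (st j)).
have stS : st j.+1 = step G o (st j) by exact: run_sequentialS.
have rem0 i : remaining (agents (st j) i) = 0 by rewrite ag.
have dest_vis i : dest (agents (st j) i) \in visited (st j).
  rewrite ag vis /=; rewrite /position.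
  have := mem_last s [seq m.2 | m <- take j (moves F) & m.1 == i :> nat].
  rewrite inE => /orP[/eqP ->|/mapP[m' + ->]]; first exact: mem_head.
  rewrite mem_filter => /andP[_ m'T].
  by rewrite inE; apply/orP; right; apply/mapP; exists m'.
have target_o : target o =1 (fun i => if i == a then Some m.2 else None).
  by move=> i; rewrite /o /sequential_order /= jT nthT.
have len_a : len G (dest (agents (st j) a)) m.2 =
    Some (label F m.2 - label F (parent F m.2)).
  by rewrite ag /= -mpar; exact: (len_parent sF).
have alarm_a : label F m.2 - label F (parent F m.2) <= (alarm o)%:num.
  have := @depart_le_alarm _ _ G (st j) (target o) a (fun=> dest_vis a).
  by rewrite /depart rem0 eqxx target_o eqxx /= len_a.
have [clkS agS visS] := step_one_agent rem0 target_o len_a alarm_a.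
have tk : take j.+1 (moves F) = rcons (take j (moves F)) m by rewrite (take_nth (0, 0)%N).
have posS i : position s (take j.+1 (moves F)) i =
    if i == m.1 then m.2 else position s (take j (moves F)) i.
  by rewrite tk position_rcons.
have agS' (i : 'I_n.+2) : let p := position s (take j.+1 (moves F)) i in
    agents (st j.+1) i = Agent p 0 (label F p).
  rewrite /= stS agS posS; have [->|ia] := eqVneq i a.
    by rewrite /= eqxx ag /= -mpar; congr Agent; lra.
  by rewrite ag ifN //; apply: contra ia => /eqP h; apply/eqP/val_inj.
split; last first.
  move=> c unit; rewrite stS clkS mulrS addrC; apply: lerD; first exact: units.
  exact: unit len_a.
split=> //.
- move=> y; rewrite tk map_rcons -rcons_cons mem_rcons [RHS]inE -vis stS visS orbC.
  have [->|ym] := eqVneq y m.2.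
    by apply/orP; left; apply/existsP; exists a; rewrite agS eqxx.
  case yv: (y \in visited (st j)); rewrite ?orbT // orbF orFb; apply/negbTE.
  apply/existsP => -[i]; rewrite agS; case: (i == a) => /= /eqP E.
    by move: ym; rewrite E eqxx.
  by move: yv; rewrite -E dest_vis.
- rewrite stS clkS clk (bigD1 a) // [in RHS](bigD1 a) // agS eqxx addrAC.
  congr (_ + _ + _).
  by apply: eq_bigr => i ia; rewrite agS (negbTE ia).
Qed.

(* An agent on its way home, in the return phase: [D] bounds the distance of
   every node from the root, and [C] the time at which the agent gets home. *)
Definition homing (D C c : R) (a : agent R) : Prop :=
  [/\ dest a \in s :: found F, 0 <= remaining a,
      odo a + label F (dest a) <= 2 * D, remaining a + label F (dest a) <= D
    & (dest a = s /\ remaining a = 0) \/ c + remaining a + label F (dest a) <= C].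

(** The number of arrivals still ahead of an agent walking home; the sum over all agents is the
    termination measure of the return phase. *)
Definition hops (a : agent R) : nat := size (route F (dest a)) + (0 < remaining a)%R.

Let back (a : agent R) := depart G (Some (parent F (dest a))) a.

(** Departure to the parent takes the edge length off the label of [dest] and adds it to both [odo]
    and [remaining], so all sums persist. The edge entered makes up for the shorter route in
    [hops]. *)
Lemma homing_depart (D C c : R) (a : agent R) : homing D C c a ->
  [/\ homing D C c (back a), hops (back a) = hops a
    & if (dest a == s) && (remaining a == 0) then back a = a else 0 < remaining (back a)].
Proof.
rewrite /back /depart; case: eqP => [r0|/eqP rN] ha; last first.
  rewrite andbF; split=> //.
  by have [_ r0 _ _ _] := ha; rewrite lt_neqAle eq_sym rN.
have [dF _ h1 h2 h3] := ha; rewrite andbT.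
have [ds|ds] := eqVneq (dest a) s.
  by rewrite /= ds (parent_root sF) len_irr.
have xF : dest a \in found F by move: dF; rewrite inE (negbTE ds).
rewrite /= len_sym (len_parent sF xF) /=.
have l0 := len_gt0 (len_parent sF xF).
split=> //.
  split=> /=; first exact: (parent_found sF); try lra.
  by right; case: h3 => [[E]|]; [rewrite E eqxx in ds|lra].
by rewrite /hops /= r0 ltxx l0 (route_found sF xF) size_rcons addn0 addn1.
Qed.

(** Away from the root every agent is moving, so [c + remaining a] stays constant and the deadline
    [C] is kept. *)
Lemma homing_advance (D C c dt : R) (a : agent R) : homing D C c a ->
    0 <= dt -> (0 < remaining a -> dt <= remaining a) ->
    (0 < remaining a \/ dest a = s) ->
  [/\ homing D C (c + dt) (advance dt a), (hops (advance dt a) <= hops a)%N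
    & 0 < remaining a -> dt = remaining a -> (hops (advance dt a) < hops a)%N].
Proof.
move=> [dF r0 h1 h2 h3] dt0 dtr ra; rewrite /advance /hops /=.
have [rp|rn] := ltP 0 (remaining a).
  rewrite max_r ?subr_ge0 ?dtr //; split.
  - split=> //=; [by rewrite subr_ge0 dtr|lra|].
    by right; case: h3 => [[_ E]|]; [rewrite E ltxx in rp|lra].
  - by rewrite leq_add2l leq_b1.
  - by move=> _ ->; rewrite subrr ltxx addn0 addn1.
have r00 : remaining a = 0 by apply/le_anti/andP.
rewrite max_l ?ltxx; last by rewrite r00 sub0r oppr_le0.
split=> //; split=> //=; first by rewrite -r00.
by left; case: ra => //; rewrite r00 ltxx.
Qed.

Definition returning (D C : R) (S : state R n.+2) : Prop :=
  [/\ {subset node G <= visited S}, clock S <= C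
    & forall i, homing D C (clock S) (agents S i)].

(** Some agent is not yet home, so after the departures someone is moving; the alarm does not
    precede the first arrival, and that arrival decreases the total of [hops]. *)
Lemma run_returning (D C : R) (j : nat) : (size (moves F) <= j)%N ->
    returning D C (st j) -> ~~ finished G s (st j) ->
  returning D C (st j.+1) /\
  (\sum_i hops (agents (st j.+1) i) < \sum_i hops (agents (st j) i))%N.
Proof.
move=> Jj [vis clk home] unfin.
set o := sequential_order s j (observe G (st j)).
have stS : st j.+1 = step G o (st j) by exact: run_sequentialS.
have Fvis : {subset s :: found F <= visited (st j)}.
  by move=> x /(found_node sG sF) /vis.
have target_o i : target o i = Some (parent F (dest (agents (st j) i))).
  have mvis : {subset [seq m.2 | m <- take j (moves F)] <= visited (st j)}.
    by move=> x /moves_found xF; apply: Fvis; rewrite inE xF orbT.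
  have := grown_revealed sG (vis _ sG) mvis; rewrite -/F ltnNge Jj => TF.
  by rewrite /o /sequential_order; cbv zeta beta; rewrite TF ltnNge Jj.
pose b i := depart G (target o i) (agents (st j) i).
have bE i : b i = back (agents (st j) i) by rewrite /b target_o.
have alarm_b i : remaining (b i) <= (alarm o)%:num.
  by apply: depart_le_alarm => _; apply: Fvis; have [] := home i.
have [i0 away] : exists i, ~~ ((dest (agents (st j) i) == s) && (remaining (agents (st j) i) == 0)).
  apply/existsP; rewrite -negb_forall; apply: contra unfin => h.
  by rewrite /finished h andbT; apply/fsubsetP.
have bi0 : 0 < remaining (b i0).
  by have [_ _] := homing_depart (home i0); rewrite (negbTE away) -bE.
rewrite stS /step -/b; set dt := \big[_/_]_(_ < _ | _) _.
have dt_le i : 0 < remaining (b i) -> dt <= remaining (b i).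
  move=> ri; exact: (@bigmin_le_cond _ _ _ (alarm o)%:num i
    (fun i => 0 < remaining (b i)) (fun i => remaining (b i)) ri).
have [i1 ri1 dti1] : exists2 i, 0 < remaining (b i) & dt = remaining (b i).
  have [i1 ri1 E] := @eq_bigmin _ _ _ (alarm o)%:num i0
    (fun i => 0 < remaining (b i)) (fun i => remaining (b i)) bi0 (fun i _ => alarm_b i).
  by exists i1.
have dt0 : 0 <= dt by rewrite dti1 ltW.
have adv i : [/\ homing D C (clock (st j) + dt) (advance dt (b i)),
    (hops (advance dt (b i)) <= hops (agents (st j) i))%N
  & 0 < remaining (b i) -> dt = remaining (b i) ->
    (hops (advance dt (b i)) < hops (agents (st j) i))%N].
  have [hb <- dis] := homing_depart (home i); rewrite -bE in hb dis *.
  apply: homing_advance => //; first exact: dt_le.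
  by move: dis; case: ifP => [/andP[/eqP E _] ->|]; [right|left].
split; last first.
  rewrite (bigD1 i1) //= [X in (_ < X)%N](bigD1 i1) //= -addSn.
  apply: leq_add; first by have [_ _] := adv i1; apply.
  by apply: leq_sum => i _; have [] := adv i.
split=> /=.
- by move=> x /vis xv; rewrite in_fsetU xv.
(* The agent arriving first was under way, so its own deadline bounds the new time. *)
- have [] := home i1; have := homing_depart (home i1); rewrite -bE.
  case=> -[bF _ _ _ h3] _ _ _ _ _ _ _.
  have := label_ge0 bF; case: h3 => [[_ E]|]; last by rewrite dti1; lra.
  by move: ri1; rewrite E ltxx.
- by move=> i; have [] := adv i.
Qed.

Lemma sequential_finishes (D : R) : {in node G, forall x, label F x <= D} ->
  exists j, let S := (run (@sequential R n) G s j).1 in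
  [/\ finished G s S, max_energy S <= 2 * D & elapsed_time S <= n.+3%:R * D].
Proof.
move=> labD.
have labF x : x \in s :: found F -> label F x <= D by move=> /(found_node sG sF) /labD.
have D0 : 0 <= D by rewrite -(label_root sF) labF ?mem_head.
(* At most [D] for each of [n + 2] successive outward walks, and [D] for the simultaneous return. *)
pose C := n.+3%:R * D.
have [[ag vis clk] _] := run_outbound (leqnn (size (moves F))).
have posF (i : 'I_n.+2) : position s (moves F) i \in s :: found F.
  rewrite (position_moves sF); have [isz|isz] := ltnP i (size (posts F)).
    by rewrite inE (posts_sub sF) ?orbT ?mem_nth.
  by rewrite nth_default ?mem_head.
have clkD : clock (st (size (moves F))) <= n.+2%:R * D.
  rewrite clk; apply: le_trans (_ : \sum_(i < n.+2) D <= _).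
    by apply: ler_sum => i _; rewrite ag take_size /= labF.
  by rewrite sumr_const card_ord mulr_natl.
have start : returning D C (st (size (moves F))).
  have CD : C = n.+2%:R * D + D by rewrite /C -[n.+3]addn1 natrD mulrDl mul1r.
  split; first by move=> x /allF; rewrite vis take_size inE => /orP[/eqP ->|/(found_moves sF) xm];
    rewrite inE ?eqxx // xm orbT.
  - by rewrite CD (le_trans clkD) // lerDl.
  - move=> i; rewrite ag take_size; have xF := posF i; have xD := labF _ xF.
    by split=> //=; lra.
have : exists2 j, (size (moves F) <= j)%N & returning D C (st j) by exists (size (moves F)).
move=> {ag vis clk clkD start} [j].
have [m] := ubnP (\sum_i hops (agents (st j) i)).
elim: m j => // m IH j mj Jj ret.
have [fin|unfin] := boolP (finished G s (st j)).
  exists j; split=> //; last by case: ret.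
  case: ret => _ _ home; apply: bigmax_le => [|i _]; first by rewrite mulr_ge0.
  case: (home i) => dF _ + _ _.
  by have := label_ge0 dF; rewrite /st; lra.
have [retS lt] := run_returning Jj ret unfin.
by apply: (IH j.+1) => //; [exact: leq_trans lt _|exact: leqW].
Qed.

End Execution.

(** * Degrees in a tadpole graph and the number of agents *)

Lemma mem_flatten_uniq (T : eqType) (r : seq (T * seq T)) (a b : T * seq T) (x : T) :
  uniq (flatten [seq t.2 | t <- r]) -> a \in r -> b \in r ->
  x \in a.2 -> x \in b.2 -> a = b.
Proof.
elim: r => // t r IH /=; rewrite cat_uniq => /and3P[_ /hasPn dis ur].
have out c : c \in r -> x \in c.2 -> x \notin t.2.
  move=> cr xc; apply: dis; apply/flattenP; exists c.2 => //; exact: map_f.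
rewrite !inE => /orP[/eqP->|ar] /orP[/eqP->|br] // xa xb; last exact: IH.
  by move: (out b br xb); rewrite xa.
by move: (out a ar xa); rewrite xb.
Qed.

(** Take for [w u] the number of tails attached to [u]. A cycle node has two neighbours on the cycle
    and one on each attached tail; a tail node has at most two neighbours, both in the list formed
    by its tail and the attachment node. *)
Lemma tadpole_degree (R : realType) (n : nat) (G : graph R) : tadpole n G ->
  exists w : nat -> nat, (\sum_(u <- node G) w u <= n)%N /\
    forall u r, u \in node G -> uniq r -> all (edge G u) r -> (size r <= 2 + w u)%N.
Proof.
move=> [c [ts [_ szts ats uts [nodeG edgeG]]]].
exists (fun u => count (fun t => t.1 == u) ts); split.
  under eq_bigr do rewrite -sum1_count big_mkcond.
  rewrite exchange_big /= -szts -sum1_size; apply: leq_sum => t _.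
  rewrite -big_mkcond sum1_count /=.
  rewrite (eq_count (a2 := pred1 t.1)) ?count_uniq_mem ?fset_uniq ?leq_b1 //.
move: uts; rewrite cat_uniq => /and3P[uc /hasPn dis uf].
have tc t : t \in ts -> t.1 \in c by move/(allP ats)/andP=> [].
have notc t x : t \in ts -> x \in t.2 -> x \notin c.
  by move=> tt xt; apply: dis; apply/flattenP; exists t.2 => //; exact: map_f.
have ut t : t \in ts -> uniq (t.1 :: t.2).
  move=> tt /=; apply/andP; split; first by apply/negP => /(notc _ _ tt); rewrite tc.
  elim: (ts) tt uf => // t' r IH /=; rewrite inE cat_uniq.
  by move=> /orP[/eqP->|/IH h] /and3P[// _ _ /h].
(* Consecutive nodes of a tail determine each other by position, and a cycle node can only come
   first. *)
have link t x y : t \in ts -> infix [:: x; y] (t.1 :: t.2) ->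
    [/\ y \in t.2, y = nth 0%N (t.1 :: t.2) (index x (t.1 :: t.2)).+1,
        x = nth 0%N (t.1 :: t.2) (index y (t.1 :: t.2)).-1
      & x \in c -> t.1 = x /\ y = head 0%N t.2].
  move=> tt /infixP[r1 [r2 E]].
  have := ut _ tt; rewrite E => ur.
  have [x1 y1] : x \notin r1 /\ y \notin rcons r1 x.
    move: ur; rewrite /= -cat_rcons -cat_rcons cat_uniq rcons_uniq => /andP[/andP[y1 +] _].
    by rewrite rcons_uniq => /andP[].
  have yt : y \in t.2.
    case: r1 E {ur x1 y1} => [[_ ->]|z r1 [_ ->]]; first by rewrite mem_head.
    by rewrite mem_cat !inE eqxx !orbT.
  split=> //.
  - by rewrite index_cat (negbTE x1) /= eqxx addn0 nth_cat ltnNge leqnSn /= subSnn.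
  - rewrite -cat_rcons -cat_rcons in y1 *.
    rewrite index_cat mem_rcons mem_head nth_cat size_rcons.
    rewrite -cats1 index_cat (negbTE y1) /= eqxx addn0 size_rcons /= leqnSn.
    by rewrite nth_cat size_rcons ltnSn nth_rcons ltnn eqxx.
  - move=> xc; case: r1 E {ur x1 y1} => [[-> ->]//|z r1 [_ E]].
    by move: (notc _ x tt); rewrite E mem_cat mem_head orbT xc => /(_ isT).
move=> u r uG ur ue.
have uedge v : v \in r -> tadpole_link c ts u v || tadpole_link c ts v u.
  by move=> /(allP ue); rewrite edgeG.
have [uc'|uc'] := boolP (u \in c).
  rewrite -size_filter.
  rewrite (_ : (2 + _)%N = size ([:: next c u; prev c u] ++
    [seq head 0%N t.2 | t <- ts & t.1 == u])); last by rewrite /= size_map.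
  apply: uniq_leq_size => // v /uedge /orP[]; rewrite /tadpole_link ?uc' /=.
    case/orP => [/eqP->|/hasP[t tt /(link _ _ _ tt)[_ _ _ /(_ uc')[tu ->]]]].
      by rewrite mem_head.
    rewrite !inE; apply/orP; right; apply/orP; right; apply: (map_f (fun t => head 0%N t.2)).
    by rewrite mem_filter tu eqxx.
  case/orP => [/andP[vc /eqP->]|/hasP[t tt /(link _ _ _ tt)[ut2 _ _ _]]].
    by rewrite prev_next // !inE eqxx orbT.
  by have := notc _ _ tt ut2; rewrite uc'.
have /flattenP[_ /mapP[t0 tt0 ->] ut0] : u \in flatten [seq t.2 | t <- ts].
  by move: uG; rewrite nodeG mem_cat (negbTE uc').
apply: (@leq_trans 2); last by rewrite leq_addr.
pose l := t0.1 :: t0.2.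
(* At the end of a tail the successor is the default value 0, which is harmless in an upper
   bound. *)
apply: (@uniq_leq_size _ r [:: nth 0%N l (index u l).+1; nth 0%N l (index u l).-1]) => //.
move=> v /uedge /orP[]; rewrite /tadpole_link ?(negbTE uc') /=.
  case/hasP => t tt uvt; have [_ E _ _] := link _ _ _ tt uvt.
  have /mem_infix/(_ u) : infix [:: u; v] (t.1 :: t.2) by exact: uvt.
  rewrite mem_head => /(_ isT).
  rewrite inE => /orP[/eqP utc|utt]; first by move: uc'; rewrite utc tc.
  by rewrite inE E (mem_flatten_uniq uf tt tt0 utt ut0) eqxx.
case/orP => [/andP[vc /eqP uE]|/hasP[t tt /(link _ _ _ tt)[utt _ E _]]].
  by move: uc'; rewrite uE mem_next vc.
by rewrite !inE E (mem_flatten_uniq uf tt tt0 utt ut0) eqxx orbT.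
Qed.

(** The children of a non-root node, together with its parent, number at most [2 + w u], so its term
    is at most [w u]. The root has no parent and contributes the additional 2. *)
Lemma size_posts_tadpole (R : realType) (n : nat) (G : graph R) (s : nat)
    (T : tree R) :
  tadpole n G -> s \in node G -> search_tree G s T -> (size (posts T) <= n.+2)%N.
Proof.
move=> /tadpole_degree[w [wn deg]] sG sT.
have uch u : uniq (children T u).
  by apply: filter_uniq; case/andP: (found_uniq sT).
have ech u : all (edge G u) (children T u).
  apply/allP => x; rewrite mem_filter => /andP[/eqP <- xT].
  by rewrite /edge (len_parent sT xT).
have term u : u \in node G ->
    (size (children T u) - (u != s) <= w u + 2 * (u == s))%N.
  move=> uG; have [->|us] /= := eqVneq u s.
    by rewrite subn0 muln1 addnC; exact: deg.
  rewrite muln0 addn0; have [uT|uT] := boolP (u \in found T).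
    have : (size (parent T u :: children T u) <= 2 + w u)%N.
      apply: deg => //=.
        (* The parent is not also a child, because labels strictly increase along tree edges. *)
        rewrite uch andbT; apply/negP; rewrite mem_filter => /andP[/eqP pp pT].
        have := len_gt0 (len_parent sT pT); have := len_gt0 (len_parent sT uT).
        by rewrite pp; lra.
      by rewrite ech andbT /edge len_sym (len_parent sT uT).
    by rewrite /=; lia.
  rewrite (_ : children T u = [::]) //; apply/eqP.
  rewrite -[_ == _]negbK -has_filter; apply/hasPn => y yT; apply/eqP => yu.
  by move: (parent_found sT yT); rewrite yu inE (negbTE us) (negbTE uT).
rewrite (size_posts sT); apply: (@leq_trans (\sum_(u <- node G) (w u + 2 * (u == s)))%N).
  by rewrite !big_seq; apply: leq_sum => u; exact: term.
rewrite big_split /= -big_distrr /= -[n.+2]addn2; apply: leq_add => //.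
rewrite -[X in (_ <= X)%N]muln1 leq_mul2l -big_mkcond sum1_count.
by rewrite count_uniq_mem ?fset_uniq ?leq_b1.
Qed.

(** * Upper bounds for both ratios *)

Lemma ratio_le (R : realType) (c o : \bar R) (y z : R) :
  0 < y -> 0 <= z -> (c <= (z * y)%:E)%E -> (y%:E <= o)%E -> (c / o <= z%:E)%E.
Proof.
move=> y0 z0 cy; case: o => [r| |] //; last by rewrite invey mule0 lee_fin.
rewrite lee_fin => yr; have r0 : 0 < r := lt_le_trans y0 yr.
rewrite inver gt_eqF // lee_pdivrMr // (le_trans cy) // -EFinM lee_fin.
exact: ler_wpM2l.
Qed.

Lemma ratio_ge (R : realType) (c o : \bar R) (x y : R) :
  0 <= x -> (x%:E <= c)%E -> (0 < o)%E -> (o <= y%:E)%E -> ((x / y)%:E <= c / o)%E.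
Proof.
move=> x0 xc; case: o => [r| |] //; rewrite lte_fin lee_fin => r0 ry.
rewrite inver gt_eqF // lee_pdivlMr // (le_trans _ xc) // -EFinM lee_fin.
have y0 : 0 < y := lt_le_trans r0 ry.
by rewrite mulrAC ler_pdivrMr // ler_wpM2l.
Qed.

Lemma opt_lower (R : realType) (k : nat) (G : graph R) (s v : nat) (phi : nat -> R) :
  phi s = 0 -> (forall u w l, len G u w = Some l -> phi w <= phi u + l) ->
  v \in node G ->
  ((2 * phi v)%:E <= opt (@max_energy R k.+1) G s)%E /\
  ((2 * phi v)%:E <= opt (@elapsed_time R k.+1) G s)%E.
Proof.
move=> phi_s phi_edge vG; split; apply: le_ereal_inf_tmp => _ [plan _ <-];
  apply: le_ereal_inf_tmp => _ [j fin <-]; rewrite lee_fin;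
  by have [] := finished_lower phi_s phi_edge vG fin.
Qed.

Lemma sequential_ratio (R : realType) (n : nat) (G : graph R) (s : nat) :
  tadpole n G -> s \in node G ->
  (cost (@max_energy R n.+2) (@sequential R n) G s / opt (@max_energy R n.+2) G s <= 1)%E /\
  (cost (@elapsed_time R n.+2) (@sequential R n) G s / opt (@elapsed_time R n.+2) G s
     <= (3%:R / 2%:R + n%:R / 2%:R)%:E)%E.
Proof.
move=> tG sG; have sF := search_tree_spanning sG; have allF := complete_spanning sG.
have [v vG vmax] := seq_argmin (fun x => - label (spanning G s) x) sG.
set D := label (spanning G s) v.
have labD : {in node G, forall x, label (spanning G s) x <= D}.
  by move=> x /vmax; rewrite lerN2.
(* The cycle contains a node other than [s], whose label is positive. *)
have D0 : 0 < D.
  have [x xG xs] : exists2 x, x \in node G & x != s.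
    have [c [ts [sz _ _ uts [nodeG _]]]] := tG.
    case: c sz uts nodeG => [//|a [//|b c]] _ /= /andP[+ _] nodeG.
    rewrite inE negb_or => /andP[ab _].
    have [as_|as_] := eqVneq a s.
      by exists b; [rewrite nodeG !inE eqxx orbT|rewrite -as_ eq_sym].
    by exists a; rewrite // nodeG mem_head.
  have xF : x \in found (spanning G s) by have := allF x xG; rewrite inE (negbTE xs).
  apply: lt_le_trans (labD x xG); have := len_gt0 (len_parent sF xF).
  by have := label_ge0 sG (parent_found sF xF); lra.
(* The labels of the complete tree serve as the potential of the lower bound. *)
have lip u w l : len G u w = Some l ->
    label (spanning G s) w <= label (spanning G s) u + l.
  move=> uw; apply: (label_edge sF _ _ uw); apply: allF; first exact: len_node uw.
  by move: uw; rewrite len_sym; exact: len_node.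
have [optE optT] := opt_lower n.+1 (label_root sF) lip vG.
have [j [fin eD tD]] := sequential_finishes sG (size_posts_tadpole tG sG sF) labD.
split; apply: (@ratio_le _ _ _ (2 * D)); rewrite -/D in optE optT;
    rewrite ?mulr_gt0 ?addr_ge0 ?divr_ge0 ?ler0n //.
- rewrite mul1r; apply: le_trans (_ : (_ <= (max_energy (run (@sequential R n) G s j).1)%:E)%E) _.
    by apply: ereal_inf_lbound; exists j.
  by rewrite lee_fin.
- apply: le_trans (_ : (_ <= (elapsed_time (run (@sequential R n) G s j).1)%:E)%E) _.
    by apply: ereal_inf_lbound; exists j.
  rewrite lee_fin (le_trans tD) // -[n.+3]addn3 natrD.
  by rewrite le_eqVlt; apply/orP; left; apply/eqP; lra.
Qed.

(** * The extremal example: a triangle with [n] pendant edges *)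

Lemma le_clock_step (R : realType) (k : nat) (G : graph R) (d : decision R k) (st : state R k) :
  clock st <= clock (step G d st).
Proof. by rewrite /= lerDl; apply: le_bigmin => // i; exact: ltW. Qed.

Lemma le_clock_run (R : realType) (k : nat) (sigma : strategy R k) (G : graph R) (s i j : nat) :
  (i <= j)%N -> clock (run sigma G s i).1 <= clock (run sigma G s j).1.
Proof.
move/subnK <-; elim: (j - i)%N => // m IH; apply: le_trans IH _.
by rewrite addSn /=; case: (run _ _ _ (m + i)) => st h; exact: le_clock_step.
Qed.

Lemma clock_step_unit (R : realType) (k : nat) (G : graph R) (d : decision R k) (st : state R k) :
  (forall u v l, len G u v = Some l -> 1 <= l) ->
  (forall i, remaining (agents st i) = 0) -> 1 <= (alarm d)%:num ->
  clock st + 1 <= clock (step G d st).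
Proof.
move=> unit rem0 d1; rewrite /= lerD2l; apply: le_bigmin => // i.
rewrite /depart rem0 eqxx; case: (target d i) => [w|] /=; last by rewrite rem0 ltxx.
by case E: (len G _ w) => [l|] /=; [move=> _; exact: unit E|rewrite rem0 ltxx].
Qed.

Lemma step_together (R : realType) (k : nat) (G : graph R) (d : decision R k)
    (st : state R k) (t : 'I_k -> nat) :
  (forall i, remaining (agents st i) = 0) -> (forall i, target d i = Some (t i)) ->
  (forall i, len G (dest (agents st i)) (t i) = Some 1) -> (alarm d)%:num = 1 ->
  [/\ clock (step G d st) = clock st + 1,
      forall i, agents (step G d st) i = Agent (t i) 0 (odo (agents st i) + 1),
      {subset visited st <= visited (step G d st)}
    & forall i, t i \in visited (step G d st)].
Proof.
move=> rem0 td l1 d1.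
have dep i : depart G (target d i) (agents st i) = Agent (t i) 1 (odo (agents st i) + 1).
  by rewrite /depart rem0 eqxx td /= l1.
rewrite /step; set dt := \big[_/_]_(_ < _ | _) _.
have dt1 : dt = 1 by rewrite /dt d1; apply: bigmin_eq_id => i _; rewrite dep.
have adv i : advance dt (depart G (target d i) (agents st i)) =
    Agent (t i) 0 (odo (agents st i) + 1).
  by rewrite dep /advance dt1 /= subrr maxxx.
split=> /=; [by rewrite dt1 | exact: adv | by move=> x xv; rewrite in_fsetU xv |].
move=> i; rewrite in_fsetU; apply/orP; right; apply/imfsetP; exists i => /=.
  rewrite !inE /=.
  change (remaining (advance dt (depart G (target d i) (agents st i))) == 0).
  by rewrite adv.
by rewrite dep.
Qed.

Section Star.
Context (R : realType) (n : nat).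

(** Node 0 is the root and is adjacent to all of [1, ..., n + 2], so the [n + 2] agents can visit
    one node each at the same time. *)
Definition star_cycle : seq nat := [:: 0; 1; 2]%N.
Definition star_tails : seq (nat * seq nat) := [seq (0%N, [:: i.+3]) | i <- iota 0 n].

(** [tadpole_link] is oriented along the cycle, so the edge between 0 and 2 appears only as a link
    from 2 to 0. *)
Lemma star_linkE (u v : nat) : tadpole_link star_cycle star_tails u v =
  [|| (u == 0) && (0 < v < n.+3) && (v != 2), (u == 1) && (v == 2) | (u == 2) && (v == 0)]%N.
Proof.
rewrite /tadpole_link /star_tails has_map.
rewrite (eq_has (a2 := fun i => (u == 0%N) && (v == i.+3))); last first.
  by move=> i; case: u => [|u] /=; rewrite ?andbF ?andbT ?orbF // eq_sym.
have -> : has (fun i => (u == 0%N) && (v == i.+3)) (iota 0 n) = (u == 0%N) && (2 < v < n.+3)%N.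
  apply/hasP/andP => [[i + /andP[-> /eqP ->]]|[-> vn]]; first by rewrite mem_iota.
  by exists (v - 3)%N; rewrite ?mem_iota; lia.
case: u => [|[|[|u]]]; rewrite /star_cycle /= ?inE ?orbF /=; lia.
Qed.

Lemma star_edge (v : nat) : (0 < v < n.+3)%N ->
  tadpole_link star_cycle star_tails 0 v || tadpole_link star_cycle star_tails v 0.
Proof. by rewrite !star_linkE; lia. Qed.

Definition star_len (u v : nat) : option R :=
  if tadpole_link star_cycle star_tails u v || tadpole_link star_cycle star_tails v u
  then Some 1 else None.

Definition star_node : {fset nat} := [fset x in iota 0 n.+3]%fset.

Lemma mem_star_node (x : nat) : (x \in star_node) = (x < n.+3)%N.
Proof. by rewrite /star_node in_fset (mem_iota 0 n.+3). Qed.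

Lemma star_len_sym (u v : nat) : star_len u v = star_len v u.
Proof. by rewrite /star_len orbC. Qed.

Lemma star_len_irr (u : nat) : star_len u u = None.
Proof. by rewrite /star_len !star_linkE; case: ifP => //; lia. Qed.

Lemma star_len_node (u v : nat) (l : R) : star_len u v = Some l -> u \in star_node.
Proof.
rewrite /star_len !star_linkE mem_star_node; case: ifP => // + _; lia.
Qed.

Lemma star_len1 (u v : nat) (l : R) : star_len u v = Some l -> l = 1.
Proof. by rewrite /star_len; case: ifP => // _ [->]. Qed.

Lemma star_len_gt0 (u v : nat) (l : R) : star_len u v = Some l -> 0 < l.
Proof. by move/star_len1 ->. Qed.

Lemma star_len0 (v : nat) : (0 < v < n.+3)%N -> star_len 0 v = Some 1.
Proof. by rewrite /star_len => /star_edge ->. Qed.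

Lemma star_connected (u v : nat) : u \in star_node -> v \in star_node ->
  exists2 p, path (fun x y => isSome (star_len x y)) u p & last u p = v.
Proof.
rewrite !mem_star_node => un vn.
have to0 x : (0 < x < n.+3)%N -> star_len x 0 = Some 1 by rewrite star_len_sym; exact: star_len0.
case: u un => [|u] un; case: v vn => [|v] vn.
- by exists [::].
- by exists [:: v.+1]; rewrite //= star_len0.
- by exists [:: 0%N]; rewrite //= to0.
- by exists [:: 0%N; v.+1]; rewrite //= to0 // star_len0.
Qed.

Definition star : graph R := Graph star_len_sym star_len_irr star_len_node
  star_len_gt0 star_connected.

Lemma star_tadpole : tadpole n star.
Proof.
exists star_cycle, star_tails.
have flat : flatten [seq t.2 | t <- star_tails] = iota 3 n.
  rewrite /star_tails -map_comp (iotaDl 3 0 n).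
  by elim: (iota 0 n) => //= i r ->.
split=> //.
- by rewrite size_map size_iota.
- by apply/allP => t /mapP[i _ ->].
- by rewrite flat; exact: (iota_uniq 0 n.+3).
split=> [x|u v]; first by rewrite flat mem_star_node -[_ ++ _]/(iota 0 n.+3) mem_iota.
by rewrite /edge /= /star_len; case: ifP.
Qed.

(** The first decision has index 1, because the history then already contains the initial
    observation. *)
Definition star_plan (j : nat) : decision R n.+2 :=
  Decision (fun i => Some (if j == 1 then i.+1 else 0)%N) 1%:pos.

Lemma opt_star : (opt (@max_energy R n.+2) star 0 <= 2%:E)%E /\
  (opt (@elapsed_time R n.+2) star 0 <= 2%:E)%E.
Proof.
pose S1 := step star (star_plan 1) (init R n.+2 0).
have [c1 a1 _ v1] : [/\ clock S1 = 0 + 1, forall i, agents S1 i = Agent i.+1 0 (0 + 1),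
    {subset visited (init R n.+2 0) <= visited S1} & forall i : 'I_n.+2, i.+1 \in visited S1].
  by apply: step_together => // i; rewrite /= star_len0 //= ltnS ltn_ord.
pose S2 := step star (star_plan 2) S1.
have [c2 a2 sub2 v2] : [/\ clock S2 = clock S1 + 1,
    forall i, agents S2 i = Agent 0 0 (odo (agents S1 i) + 1),
    {subset visited S1 <= visited S2} & forall i : 'I_n.+2, 0%N \in visited S2].
  apply: step_together => // i; first by rewrite a1.
  by rewrite a1 /= star_len_sym star_len0 //= ltnS ltn_ord.
have run2 : (run (plan_strategy star_plan) star 0 2).1 = S2 by [].
have fin : finished star 0 S2.
  apply/andP; split; last by apply/forallP => i; rewrite a2 /= !eqxx.
  apply/fsubsetP => -[_|x]; first exact: v2 ord0.
  by rewrite mem_star_node ltnS => xn; apply: sub2; exact: (v1 (Ordinal xn)).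
have le2 (f : state R n.+2 -> R) : f S2 <= 2 -> (opt f star 0 <= 2%:E)%E.
  move=> f2; apply: (@le_trans _ _ (cost f (plan_strategy star_plan) star 0)).
    by apply: ereal_inf_lbound; exists star_plan.
  apply: (@le_trans _ _ (f S2)%:E); last by rewrite lee_fin.
  by apply: ereal_inf_lbound; exists 2%N; rewrite /= ?run2.
split; apply: le2; last by rewrite /elapsed_time c2 c1 add0r -mulr2n.
by apply: bigmax_le => // i _; rewrite a2 a1 /= add0r -mulr2n.
Qed.

Lemma star_bounds : [/\ (2%:E <= cost (@max_energy R n.+2) (@sequential R n) star 0)%E,
    (0 < opt (@max_energy R n.+2) star 0)%E,
    (0 < opt (@elapsed_time R n.+2) star 0)%E
  & (n.+3%:R%:E <= cost (@elapsed_time R n.+2) (@sequential R n) star 0)%E].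
Proof.
(* The distance from the root in the star. *)
pose phi (x : nat) : R := (x != 0%N)%:R.
have lip u w l : len star u w = Some l -> phi w <= phi u + l.
  move/star_len1 ->; rewrite /phi; case: (w == 0%N); case: (u == 0%N) => /=; lra.
have n1 : 1%N \in node star by rewrite mem_star_node.
have n0 : 0%N \in node star by rewrite mem_star_node.
have phi0 : phi 0%N = 0 by [].
have [optE optT] := opt_lower n.+1 phi0 lip n1.
have pos2 : (0 < (2 * phi 1%N)%:E)%E by rewrite lte_fin /phi /= mulr1.
split; [|exact: lt_le_trans optE|exact: lt_le_trans optT|].
  apply: le_ereal_inf_tmp => _ [j fin <-]; rewrite lee_fin.
  by have [] := finished_lower phi0 lip n1 fin; rewrite /phi mulr1.
apply: le_ereal_inf_tmp => _ [j fin <-]; rewrite lee_fin /elapsed_time.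
have sF := search_tree_spanning n0.
have posts_n := size_posts_tadpole star_tadpole n0 sF.
have unit u v l : len star u v = Some l -> 1 <= l by move/star_len1 ->.
(* There are [n + 2] nodes besides the root, and each is the target of some move. *)
have card m : {subset node star <= 0%N :: m} -> (n.+2 <= size m)%N.
  move=> sub; have : {subset iota 0 n.+3 <= 0%N :: m}.
    by move=> x; rewrite mem_iota => xn; apply: sub; rewrite mem_star_node.
  by move/(uniq_leq_size (iota_uniq _ _)); rewrite size_iota.
set J := size (moves (spanning star 0)).
(* The exploration cannot be finished before a return step: with all agents at the root the
   odometers, and hence the clock, would be 0, although at least [n + 2] moves have taken unit time
   each. *)
have [jJ|Jj] := leqP j J.
  have [[ag vis clk] units] := run_outbound n0 posts_n jJ.
  have : (n.+2 <= size (take j (moves (spanning star 0))))%N.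
    rewrite -(size_map snd); apply: card => x xG; rewrite -vis.
    by case/andP: fin => /fsubsetP/(_ _ xG).
  rewrite size_takel // => nj; have := units 1 unit; rewrite clk big1 => [|i _].
    by rewrite lern0; case: (j) nj.
  case/andP: fin => _ /forallP/(_ i); rewrite ag /= => /andP[/eqP -> _].
  exact: (label_root sF).
have [[ag vis clk] units] := run_outbound n0 posts_n (leqnn J).
(* The moves take at least [n + 2], and the first step of the return phase at least 1 more. *)
apply: le_trans (le_clock_run _ _ _ Jj).
rewrite run_sequentialS; apply: (le_trans _ (clock_step_unit unit _ _)).
- rewrite -[n.+3]addn1 natrD lerD2r; apply: le_trans (units 1 unit); rewrite ler_nat.
  rewrite /J -(size_map snd); apply: card => x xG.
  have := complete_spanning n0 xG; rewrite !inE => /orP[->//|/(found_moves sF) ->].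
  by rewrite orbT.
- by move=> i; rewrite ag.
- by rewrite /= lerDr.
Qed.

End Star.

Theorem theorem12 (R : realType) (n : nat) :
  exists sigma : strategy R n.+2,
    competitive_ratio (@max_energy R n.+2) (@tadpole R n) sigma = 1%:E /\
    competitive_ratio (@elapsed_time R n.+2) (@tadpole R n) sigma
      = (3%:R / 2%:R + n%:R / 2%:R)%:E.
Proof.
exists (@sequential R n).
have [costE optE0 optT0 costT] := star_bounds R n.
have [optE optT] := opt_star R n.
have n0 : 0%N \in node (star R n) by rewrite mem_star_node.
split; apply/le_anti/andP; split.
- by apply: ge_ereal_sup => _ [G [s [tG sG ->]]]; have [] := sequential_ratio tG sG.
- apply: (@le_trans _ _ (2 / 2)%:E); first by rewrite divff.
  apply: le_trans (ratio_ge _ costE optE0 optE) _ => //.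
  by apply: ereal_sup_ubound; exists (star R n), 0%N; split => //; exact: star_tadpole.
- by apply: ge_ereal_sup => _ [G [s [tG sG ->]]]; have [] := sequential_ratio tG sG.
(* On the star the strategy needs at least [n + 3], against an optimum of at most 2. *)
- rewrite -mulrDl -natrD add3n.
  apply: le_trans (ratio_ge _ costT optT0 optT) _ => //.
  by apply: ereal_sup_ubound; exists (star R n), 0%N; split => //; exact: star_tadpole.
Qed.
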